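(* Let $E$ and $Z$ be real Hausdorff topological vector spaces, let $X\subset E$ be a convex set, let $Y\subset Z$ be compact, and let $S$ be a pointed closed convex cone in $Z$ with $\operatorname{int}S\neq\emptyset$. Let $F:X\times X\rightrightarrows Y$ be a set-valued map with non-empty values. (i) Suppose that $F$ satisfies property $(\alpha)$. If $F$ is transfer type-(iii) properly $S$-quasi-concave in the first argument on $X\times X$ and also satisfies condition $(\gamma)$, then there exist $z_1\in \operatorname{Max}\overline{\bigcup_{x\in X}F(x,x)}$ and $z_2\in\operatorname{Min}\overline{\bigcup_{x\in X}\operatorname{Max}_w F(x,X)}$ such that $z_1\in z_2+S$. (ii) Suppose that $F$ satisfies property $(\alpha')$. If $F$ is transfer type-(iii) properly $S$-quasi-convex in the second argument on $X\times X$ and also satisfies condition $(\gamma')$, then there exist $z_1\in \operatorname{Min}\overline{\bigcup_{x\in X}F(x,x)}$ and $z_2\in\operatorname{Max}\overline{\bigcup_{y\in X}\operatorname{Min}_w F(X,y)}$ such that $z_1\in z_2-S$.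
   Context: Notation: $\overline{A}$ is the closure and $\operatorname{co}A$ the convex hull of $A$. $F(x,X)=\bigcup_{y\in X}F(x,y)$, $F(X,y)=\bigcup_{x\in X}F(x,y)$. $-F$ is the map $(x,y)\mapsto -F(x,y)$. For non-empty $A\subset Z$: $z\in A$ belongs to $\operatorname{Min}A$ iff $A\cap(z-S)=\{z\}$; to $\operatorname{Max}A$ iff $A\cap(z+S)=\{z\}$; to $\operatorname{Min}_wA$ iff $A\cap(z-\operatorname{int}S)=\emptyset$; to $\operatorname{Max}_wA$ iff $A\cap(z+\operatorname{int}S)=\emptyset$. Property $(\alpha)$: for each $x\in X$, $\bigcup_{y\in X}F(x,y)$ is compact and there exists $z_x\in\operatorname{Max}\bigcup_{y\in X}F(x,y)$ such that $\bigcup_{y\in X}F(x,y)\subset z_x-S$. Property $(\alpha')$: for each $y\in X$, $\bigcup_{x\in X}F(x,y)$ is compact and there exists $z_y\in\operatorname{Min}\bigcup_{x\in X}F(x,y)$ such that $\bigcup_{x\in X}F(x,y)\subset z_y+S$. $F$ is transfer type-(iii) properly $S$-quasi-convex in the first argument on $X\times X$ iff for all $x_1,x_2,z\in X$, $\lambda\in(0,1)$ and $i\in\{1,2\}$: $F(\lambda x_1+(1-\lambda)x_2,z)\cap\operatorname{Min}_w\bigcup_{y\in X}F(x_i,y)=\emptyset$ implies $F(x_i,z)\subset F(\lambda x_1+(1-\lambda)x_2,z)+S$. $F$ has the quasi-concave version iff $-F$ has the quasi-convex version; $F$ has the property in the second argument iff the map $(x,y)\mapsto F(y,x)$ has it in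 the first argument. Condition $(\gamma)$: there exist $m\ge1$, $(x_1,y_1),\dots,(x_m,y_m)\in X\times X$ and $y^*\in\operatorname{co}\{x_1,\dots,x_m\}$ such that for each $i$: $F(x_i,y_i)\subset F(x_i,y^* )-S$ and $F(x_i,y_i)\cap\operatorname{Max}_w\bigcup_{z\in X}F(x_i,z)\neq\emptyset$. Condition $(\gamma')$: there exist $m\ge1$, $(x_1,y_1),\dots,(x_m,y_m)\in X\times X$ and $x^*\in\operatorname{co}\{y_1,\dots,y_m\}$ such that for each $i$: $F(x_i,y_i)\subset F(x^*,y_i)+S$ and $F(x_i,y_i)\cap\operatorname{Min}_w\bigcup_{x\in X}F(x,y_i)\neq\emptyset$. *)

(* Defs.v *)
From mathcomp Require Import all_boot all_order all_algebra.
From mathcomp Require Import all_classical all_reals all_analysis.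

Set Implicit Arguments.
Unset Strict Implicit.
Unset Printing Implicit Defensive.

Import Order.TTheory GRing.Theory Num.Theory.
Import numFieldNormedType.Exports.

Local Open Scope classical_set_scope.
Local Open Scope ring_scope.

Section Cones.
Context {R : realType} {Z : topologicalLmodType R}.
Implicit Types (S A B : set Z).

(* Allowing t = 0 costs nothing: a non-empty closed set that is stable under
   positive scalings contains 0. *)
Definition is_cone S := forall (t : R) (s : Z), 0 <= t -> S s -> S (t *: s).

Definition pointed_closed_convex_cone S :=
  [/\ is_cone S, convex_set S, closed S & S `&` [set - s | s in S] = [set 0]].

Definition set_add A B : set Z := [set a + b | a in A & b in B].
Definition set_sub A B : set Z := [set a - b | a in A & b in B].

(* Efficient points are only of interest for non-empty A; when A is empty
   the four sets below are empty. *)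
Definition Min S A : set Z :=
  [set z | A z /\ A `&` set_sub [set z] S = [set z]].
Definition Max S A : set Z :=
  [set z | A z /\ A `&` set_add [set z] S = [set z]].
Definition Minw S A : set Z :=
  [set z | A z /\ A `&` set_sub [set z] (interior S) = set0].
Definition Maxw S A : set Z :=
  [set z | A z /\ A `&` set_add [set z] (interior S) = set0].

End Cones.

Section SetValuedMaps.
Context {R : realType} {E Z : topologicalLmodType R}.

(* A set-valued map on X x X is a total function E -> E -> set Z; only its
   values on X x X are constrained or used. *)
Implicit Types (S Y : set Z) (X A : set E) (F : E -> E -> set Z).

Definition convex_hull A : set E := smallest (@convex_set R E) A.

Definition set_valued_map X Y F :=
  forall x y, X x -> X y -> F x y !=set0 /\ F x y `<=` Y.

Definition opp_map F : E -> E -> set Z := fun x y => [set - z | z in F x y].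
Definition swap_map F : E -> E -> set Z := fun x y => F y x.

Definition imageR F (x : E) X : set Z := \bigcup_(y in X) F x y.
Definition imageL F X (y : E) : set Z := \bigcup_(x in X) F x y.

Definition property_alpha S X F := forall x, X x ->
  compact (imageR F x X) /\
  exists2 zx, Max S (imageR F x X) zx &
    imageR F x X `<=` set_sub [set zx] S.

Definition property_alpha' S X F := forall y, X y ->
  compact (imageL F X y) /\
  exists2 zy, Min S (imageL F X y) zy &
    imageL F X y `<=` set_add [set zy] S.

Definition transfer3_quasi_convex1 S X F :=
  forall (x1 x2 z : E) (lambda : R), X x1 -> X x2 -> X z ->
    0 < lambda < 1 ->
  forall xi, xi = x1 \/ xi = x2 ->
    F (lambda *: x1 + (1 - lambda) *: x2) z `&` Minw S (imageR F xi X) = set0 ->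
    F xi z `<=` set_add (F (lambda *: x1 + (1 - lambda) *: x2) z) S.

Definition transfer3_quasi_concave1 S X F :=
  transfer3_quasi_convex1 S X (opp_map F).

Definition transfer3_quasi_convex2 S X F :=
  transfer3_quasi_convex1 S X (swap_map F).

Definition condition_gamma S X F :=
  exists (m : nat) (x y : 'I_m -> E) (ystar : E),
    [/\ (0 < m)%N, (forall i, X (x i) /\ X (y i)),
        convex_hull (range x) ystar &
        forall i, F (x i) (y i) `<=` set_sub (F (x i) ystar) S /\
                  F (x i) (y i) `&` Maxw S (imageR F (x i) X) !=set0].

Definition condition_gamma' S X F :=
  exists (m : nat) (x y : 'I_m -> E) (xstar : E),
    [/\ (0 < m)%N, (forall i, X (x i) /\ X (y i)),
        convex_hull (range y) xstar &
        forall i, F (x i) (y i) `<=` set_add (F xstar (y i)) S /\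
                  F (x i) (y i) `&` Minw S (imageL F X (y i)) !=set0].

End SetValuedMaps.

(* Main.v *)
Require Import Defs.
From mathcomp Require Import all_boot all_order all_algebra.
From mathcomp Require Import all_classical all_reals all_analysis.

Import Order.TTheory GRing.Theory Num.Theory.
Import numFieldNormedType.Exports.

Local Open Scope classical_set_scope.
Local Open Scope ring_scope.

(** Order Z by the cone S and let A be the set of points x of X for which some
    value in F(x, ystar) dominates an element of the union over x' in X of
    Max_w F(x', X). Condition (gamma) puts every x_i in A. The set A is convex:
    given x1, x2 in A and x strictly between them, either F(x, ystar) meets
    Max_w F(x1, X), or quasi-concavity dominates every value in F(x1, ystar) by
    one in F(x, ystar). Hence ystar is in A: some u in F(ystar, ystar) lies above
    some v in the union. Compactness then gives an efficient z1 above u and an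
    efficient z2 below v. Part (ii) is the same argument for the reverse order
    and the swapped map. *)

(** Zorn's lemma on the points of [A] above [a]: every chain of them has an upper bound because [A]
    is compact and the sets of points above a given point are closed. Antisymmetry is not assumed,
    so maximality is up to equivalence. *)
Lemma compact_ge_maximal (T : topologicalType) (le : T -> T -> Prop)
    (A : set T) (a : T) :
  (forall x, le x x) -> (forall y x z, le x y -> le y z -> le x z) ->
  (forall x, closed [set y | le x y]) -> compact A -> A a ->
  exists z, [/\ A z, le a z & forall y, A y -> le z y -> le y z].
Proof.
move=> le_refl le_trans le_closed A_compact Aa.
pose P := {z : T | A z /\ le a z}.
pose le' : rel P := fun x y => `[< le (sval x) (sval y) >].
have [||C C_total|[z [Az az]] zmax] :=
    @ZL_preorder P (exist _ a (conj Aa (le_refl a))) le'.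
- by move=> x; exact/asboolP.
- move=> x y z /asboolP xy /asboolP yz; apply/asboolP; exact: le_trans xy yz.
- have [[c0 Cc0]|C0] := pselect (C !=set0); last first.
    by exists (exist _ a (conj Aa (le_refl a))) => s Cs; case: C0; exists s.
  (* The sets [up c] are nested along the chain, hence form a filter base on [A]. A cluster point
     lies in the closure of each of them, and closedness of the order makes it an upper bound of the
     chain. *)
  pose up (c : P) := A `&` [set y | le (sval c) y].
  have up_filter : ProperFilter (filter_from C up).
    apply: filter_from_proper; last first.
      by move=> [c [Ac ac]] _; exists c; split; last exact: le_refl.
    apply: filter_from_filter; first by exists c0.
    move=> c d Cc Cd; case: (C_total c d Cc Cd) => /asboolP cd.
    - exists d => // y [Ay dy]; split; split => //=; exact: le_trans cd dy.
    - exists c => // y [Ay cy]; split; split => //=; exact: le_trans cd cy.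
  have [|z [Az]] := A_compact _ up_filter.
    by exists c0 => // y [].
  rewrite clusterE => z_cluster.
  have z_ub c : C c -> le (sval c) z.
    move=> Cc; have : closure (up c) z by apply: z_cluster; exists c.
    by move=> zcl; apply: le_closed; apply: closureS zcl => y [].
  have az : le a z.
    by apply: le_trans (z_ub _ Cc0); case: (svalP c0).
  by exists (exist _ z (conj Az az)) => s Cs; apply/asboolP; exact: z_ub.
- exists z; split => // y Ay zy.
  have yP : A y /\ le a y by split => //; exact: le_trans az zy.
  by have /(_ (asboolT zy)) /asboolP := zmax (exist _ y yP).
Qed.

Section Cone.
Context {R : realType} {Z : topologicalLmodType R}.
Implicit Types (S A : set Z) (v z : Z).

Lemma set_add1P S v z : set_add [set v] S z <-> S (z - v).
Proof.
split=> [[_ -> [s Ss <-]]|Sz]; first by rewrite addrAC subrr add0r.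
by exists v => //; exists (z - v) => //; rewrite addrC subrK.
Qed.

Lemma set_sub1P S v z : set_sub [set v] S z <-> S (v - z).
Proof.
split=> [[_ -> [s Ss <-]]|Sz]; first by rewrite subKr.
by exists v => //; exists (v - z) => //; rewrite subKr.
Qed.

Context {S : set Z}.
Hypothesis S_cone : pointed_closed_convex_cone S.

Lemma cone_anti z : S z -> S (- z) -> z = 0.
Proof.
move=> Sz SNz; case: S_cone => _ _ _ S0.
suff : (S `&` [set - s | s in S]) z by rewrite S0.
by split => //; exists (- z) => //; rewrite opprK.
Qed.

Lemma cone0 : S 0.
Proof.
case: S_cone => _ _ _ S0.
by have : [set 0] (0 : Z) by []; rewrite -S0; case.
Qed.

(** The sum is twice the midpoint, which lies in [S] by convexity. *)
Lemma coneD v z : S v -> S z -> S (v + z).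
Proof.
case: S_cone => S_scale S_convex _ _ Sv Sz.
have half : (1 - 2^-1 : R) = 2^-1.
  by rewrite [X in X - _](splitr 1) div1r addrK.
have half0 : (0 : R) <= 2^-1 by rewrite invr_ge0.
have half1 : (2^-1 : R) <= 1 by rewrite invf_le1 ?ler1n.
have := set_mem (S_convex v z (Itv01 half0 half1) (mem_set Sv) (mem_set Sz)).
move=> /(S_scale 2 _ (ler0n _ _)) /=.
rewrite /conv /= /unstable.onem half -scalerDr scalerA.
by rewrite divff ?scale1r// pnatr_eq0.
Qed.

Lemma cone_closedBr v : closed [set z | S (z - v)].
Proof.
case: S_cone => _ _ S_closed _.
apply: (@preimage_closed _ _ (fun z : Z => z - v) S) => // x _.
apply: (@continuous_comp _ _ _ (fun z : Z => (z, v))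
  (fun p : Z * Z => p.1 - p.2)); last exact: sub_continuous.
by apply: cvg_pair => //=; exact: cvg_cst.
Qed.

Lemma cone_closedBl v : closed [set z | S (v - z)].
Proof.
case: S_cone => _ _ S_closed _.
apply: (@preimage_closed _ _ (fun z : Z => v - z) S) => // x _.
apply: (@continuous_comp _ _ _ (fun z : Z => (v, z))
  (fun p : Z * Z => p.1 - p.2)); last exact: sub_continuous.
by apply: cvg_pair => //=; exact: cvg_cst.
Qed.

(** The order of [S] is closed because [S] is, and antisymmetric because [S] is pointed; the latter
    turns maximality up to equivalence into membership in [Max]. *)
Lemma exists_Max_above A v : compact A -> A v ->
  exists2 z, Max S A z & S (z - v).
Proof.
move=> A_compact Av.
have [|y x z xy yz||||z [Az vz zmax]] :=
    @compact_ge_maximal Z (fun x y => S (y - x)) A v.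
- by move=> x; rewrite subrr; exact: cone0.
- by rewrite -(subrK y z) -addrA; exact: coneD.
- exact: cone_closedBr.
- exact: A_compact.
- exact: Av.
exists z => //; split => //; apply/seteqP; split=> [y [Ay /set_add1P zy]|y ->].
  by apply/subr0_eq/cone_anti => //; rewrite opprB; exact: zmax.
by split => //; apply/set_add1P; rewrite subrr; exact: cone0.
Qed.

Lemma exists_Min_below A v : compact A -> A v ->
  exists2 z, Min S A z & S (v - z).
Proof.
move=> A_compact Av.
have [|y x z xy yz||||z [Az vz zmin]] :=
    @compact_ge_maximal Z (fun x y => S (x - y)) A v.
- by move=> x; rewrite subrr; exact: cone0.
- by rewrite -(subrK y x) -addrA; exact: coneD.
- exact: cone_closedBl.
- exact: A_compact.
- exact: Av.
exists z => //; split => //; apply/seteqP; split=> [y [Ay /set_sub1P zy]|y ->].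
  by apply/subr0_eq/cone_anti; rewrite ?opprB //; exact: zmin.
by split => //; apply/set_sub1P; rewrite subrr; exact: cone0.
Qed.

End Cone.

(** Quasi-concavity is stated through the opposite map, so its premise involves [Minw] of a negated
    set; this brings it back to [Maxw]. *)
Lemma Minw_opp {R : realType} {Z : topologicalLmodType R} (S A : set Z) (z : Z) :
  Minw S [set - a | a in A] (- z) -> Maxw S A z.
Proof.
move=> [[a Aa /oppr_inj az] zmin]; subst a; split => //.
apply/seteqP; split => // y [Ay /set_add1P yz].
suff : ([set - a | a in A] `&` set_sub [set - z] (interior S)) (- y).
  by rewrite zmin.
by split; [exists y|apply/set_sub1P; rewrite opprK addrC].
Qed.

Lemma imageR_opp {R : realType} {E Z : topologicalLmodType R} (X : set E)
    (F : E -> E -> set Z) (x : E) :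
  imageR (opp_map F) x X = [set - z | z in imageR F x X].
Proof. by rewrite /imageR image_bigcup. Qed.

Section Domination.
Context {R : realType} {E : topologicalLmodType R} {T : Type}.
Context {X : set E} {G B : E -> set T} {le : T -> T -> Prop}.
Hypothesis X_convex : @convex_set R E X.
Hypothesis le_refl : forall u, le u u.
Hypothesis le_trans : forall v u w, le u v -> le v w -> le u w.
Hypothesis G_transfer : forall (x1 x2 : E) (t : R), X x1 -> X x2 ->
  0 < t < 1 -> G (t *: x1 + (1 - t) *: x2) `&` B x1 = set0 ->
  forall u, G x1 u -> exists2 v, G (t *: x1 + (1 - t) *: x2) v & le u v.

(** The set [D] below is convex and contains [A], hence contains its hull. Since [le], [G] and [B]
    are abstract, the lemma serves both parts of the theorem. *)
Lemma convex_hull_domination (A : set E) (y : E) :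
  (forall x, A x -> X x /\ exists u v, [/\ G x u, B x v & le v u]) ->
  convex_hull A y ->
  X y /\ exists u v, [/\ G y u, (\bigcup_(x in X) B x) v & le v u].
Proof.
(* The dominated value [v] may come from any [B x]: a convex combination can inherit it from an
   endpoint. *)
move=> A_dom; pose D x :=
  X x /\ exists u v, [/\ G x u, (\bigcup_(x in X) B x) v & le v u].
suff D_convex : @convex_set R E D.
  apply: (smallest_sub D_convex) => x /A_dom[Xx [u [v [Gu Bv vu]]]].
  by split => //; exists u, v; split => //; exists x.
apply/convex_setW => x1 x2 /set_mem[Xx1 [u [v [Gu Bv vu]]]] /set_mem[Xx2 _] t.
move=> t0 t1; have Xx := set_mem (X_convex x1 x2 t (mem_set Xx1) (mem_set Xx2)).
apply/mem_set; split => //.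
(* A value shared with [B x1] dominates itself; if there is none, the transfer property replaces [u]
   by a larger value and [v] is kept. *)
have [GB0|/set0P[w [Gw Bw]]] := eqVneq
    (G (t%:num *: x1 + (1 - t%:num) *: x2) `&` B x1) set0; last first.
  by exists w, w; split => //; exists x1.
have t01 : 0 < t%:num < 1 by rewrite t0.
have [w Gw uw] := G_transfer x1 x2 _ Xx1 Xx2 t01 GB0 u Gu.
by exists w, v; split => //; apply: le_trans vu uw.
Qed.

End Domination.

Theorem theorem4p4 (R : realType) (E Z : topologicalLmodType R)
    (X : set E) (Y S : set Z) (F : E -> E -> set Z)
    (E_hausdorff : hausdorff_space E) (Z_hausdorff : hausdorff_space Z)
    (X_convex : convex_set X) (Y_compact : compact Y)
    (S_cone : pointed_closed_convex_cone S) (intS_neq0 : interior S !=set0)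
    (F_map : set_valued_map X Y F) :
  (property_alpha S X F ->
   transfer3_quasi_concave1 S X F ->
   condition_gamma S X F ->
   exists z1 z2 : Z,
     [/\ Max S (closure (\bigcup_(x in X) F x x)) z1,
         Min S (closure (\bigcup_(x in X) Maxw S (imageR F x X))) z2 &
         set_add [set z2] S z1]) /\
  (property_alpha' S X F ->
   transfer3_quasi_convex2 S X F ->
   condition_gamma' S X F ->
   exists z1 z2 : Z,
     [/\ Min S (closure (\bigcup_(x in X) F x x)) z1,
         Max S (closure (\bigcup_(y in X) Minw S (imageL F X y))) z2 &
         set_sub [set z2] S z1]).
Proof.
(* Since [Z] is Hausdorff, the compact set [Y] is closed and so contains the closure of each of its
   subsets. *)
have compact_closure (A : set Z) : A `<=` Y -> compact (closure A).
  move=> AY; apply: (subclosed_compact _ Y_compact); first exact: closed_closure.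
  by rewrite [X in _ `<=` X](closure_id Y).1; [exact: closureS|exact: compact_closed].
have diagY : \bigcup_(x in X) F x x `<=` Y.
  by move=> z [x Xx]; exact: (F_map _ _ Xx Xx).2.
split.
- move=> _ F_transfer [m [x [y [ystar [_ xyX ystar_hull xy_dom]]]]].
  have ystarX : X ystar.
    by apply: (smallest_sub X_convex) ystar_hull => _ [i _ <-]; case: (xyX i).
  have [||| |_ [u [v [Fu Bv uv]]]] := @convex_hull_domination R E Z X
    (F ^~ ystar) (fun x => Maxw S (imageR F x X)) (fun u v => S (v - u))
    X_convex _ _ _ (range x) ystar _ ystar_hull.
  + by move=> w; rewrite subrr; exact: cone0 S_cone.
  + move=> w' w w'' ww' w'w''; rewrite -(subrK w' w'') -addrA.
    exact: coneD S_cone _ _ _ _.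
  + move=> x1 x2 t Xx1 Xx2 t01 FB0 w Fw.
    (* Applied to the opposite map at [- w], the property yields [- w = - w1 + s] with [s] in [S],
       so [w1 = w + s] lies above [w]. *)
    have [||_ [w1 Fw1 <-] [s Ss ww1]] :=
        F_transfer x1 x2 ystar t Xx1 Xx2 ystarX t01 x1 (or_introl erefl) _ (- w).
    * rewrite -subset0. move=> w' [[w1 Fw1 <-]]; rewrite imageR_opp => /Minw_opp Bw1.
      by have : @set0 Z w1 by rewrite -FB0.
    * by exists w.
    by exists w1 => //; rewrite -ww1 addNKr.
  + move=> _ [i _ <-]; split; first by case: (xyX i).
    have [Fxy [w [Fw Bw]]] := xy_dom i.
    have [u Fu [s Ss us]] := Fxy w Fw.
    by exists u, w; split => //; rewrite -us subKr.
  have [z1 z1Max uz1] := exists_Max_above S_cone _ _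
    (compact_closure _ diagY) (@subset_closure _ _ _ (ex_intro2 _ _ ystar ystarX Fu)).
  have BY : \bigcup_(x in X) Maxw S (imageR F x X) `<=` Y.
    by move=> z [a Xa [[b Xb Fz] _]]; exact: (F_map _ _ Xa Xb).2.
  have [z2 z2Min z2v] := exists_Min_below S_cone _ _
    (compact_closure _ BY) (@subset_closure _ _ _ Bv).
  (* Split [z1 - z2] as [(z1 - u) + (u - v) + (v - z2)], a sum of three elements of [S]. *)
  exists z1, z2; split => //; apply/set_add1P.
  rewrite -(subrK u z1) -addrA; apply: (coneD S_cone) => //.
  by rewrite -(subrK v u) -addrA; exact: (coneD S_cone).
- move=> _ F_transfer [m [x [y [xstar [_ xyX xstar_hull xy_dom]]]]].
  have xstarX : X xstar.
    by apply: (smallest_sub X_convex) xstar_hull => _ [i _ <-]; case: (xyX i).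
  (* The order is now reversed and the second argument varies. As [imageR] of [swap_map F] unfolds
     to [imageL F], the transfer hypothesis applies without translation. *)
  have [||| |_ [u [v [Fu Bv uv]]]] := @convex_hull_domination R E Z X
    (F xstar) (fun y => Minw S (imageL F X y)) (fun u v => S (u - v))
    X_convex _ _ _ (range y) xstar _ xstar_hull.
  + by move=> w; rewrite subrr; exact: cone0 S_cone.
  + move=> w' w w'' ww' w'w''; rewrite -(subrK w' w) -addrA.
    exact: coneD S_cone _ _ _ _.
  + move=> x1 x2 t Xx1 Xx2 t01 FB0 w Fw.
    have [w1 Fw1 [s Ss ww1]] :=
      F_transfer x1 x2 xstar t Xx1 Xx2 xstarX t01 x1 (or_introl erefl) FB0 w Fw.
    by exists w1 => //; rewrite -ww1 addrAC subrr add0r.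
  + move=> _ [i _ <-]; split; first by case: (xyX i).
    have [Fxy [w [Fw Bw]]] := xy_dom i.
    have [u Fu [s Ss us]] := Fxy w Fw.
    by exists u, w; split => //; rewrite -us addrAC subrr add0r.
  have [z1 z1Min uz1] := exists_Min_below S_cone _ _
    (compact_closure _ diagY) (@subset_closure _ _ _ (ex_intro2 _ _ xstar xstarX Fu)).
  have BY : \bigcup_(y in X) Minw S (imageL F X y) `<=` Y.
    by move=> z [a Xa [[b Xb Fz] _]]; exact: (F_map _ _ Xb Xa).2.
  have [z2 z2Max z2v] := exists_Max_above S_cone _ _
    (compact_closure _ BY) (@subset_closure _ _ _ Bv).
  exists z1, z2; split => //; apply/set_sub1P.
  rewrite -(subrK v z2) -addrA; apply: (coneD S_cone) => //.
  by rewrite -(subrK u v) -addrA; exact: (coneD S_cone).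
Qed.
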